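(* Let $q$ be a prime power, let $h,n,k$ be positive integers, and let $\mathcal C\subseteq\mathbb F_{q^h}^n$ be an additive code of $\mathbb F_q$-dimension $k$ with associated multiset $\mathcal X(\mathcal C)=\{\pi_1,\ldots,\pi_n\}$ of subspaces of $\mathrm{PG}(k-1,q)$. If $\mathcal C$ is nondegenerate, then $$\operatorname{crit}(\mathcal C)=\operatorname{crit}(\mathcal X(\mathcal C)).$$
   Context: An additive code $\mathcal C\subseteq\mathbb F_{q^h}^n$ is an $\mathbb F_q$-linear subspace. It is nondegenerate if for every $i\in[n]=\{1,\ldots,n\}$ the coordinate map $\mathcal C\to\mathbb F_{q^h}$, $c\mapsto c_i$, is nonzero. For an $\mathbb F_q$-subspace $\mathcal D\subseteq\mathcal C$ let $\operatorname{supp}(\mathcal D)=\bigcup_{c\in\mathcal D}\{i\in[n]:c_i\neq0\}$; $\operatorname{crit}(\mathcal C)$ is the minimum of $\dim_{\mathbb F_q}\mathcal D$ over all $\mathbb F_q$-subspaces $\mathcal D\subseteq\mathcal C$ with $\operatorname{supp}(\mathcal D)=[n]$. For a vector subspace $U\subseteq\mathbb F_q^k$, $\mathrm{PG}(U)$ is the projective space whose points are the $1$-dimensional subspaces of $U$, and $\mathrm{PG}(k-1,q)=\mathrm{PG}(\mathbb F_q^k)$. A hyperplane of $\mathrm{PG}(k-1,q)$ is $\mathrm{PG}(\Lambda)$ for a vector hyperplane $\Lambda\subseteq\mathbb F_q^k$; for $k=1$ the only hyperplane is $\mathrm{PG}(\{0\})=\emptyset$. Choose a generator matrix $G\in\mathrm{Mat}_{k,n}(\mathbb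 F_{q^h})$ of $\mathcal C$ (its rows form an $\mathbb F_q$-basis of $\mathcal C$) and an $\mathbb F_q$-basis $(\alpha_1,\ldots,\alpha_h)$ of $\mathbb F_{q^h}$. Writing $g_{j,i}=\sum_{t=1}^h b^t_{j,i}\alpha_t$ with $b^t_{j,i}\in\mathbb F_q$, let $G_i=(b^t_{j,i})_{1\le j\le k,\,1\le t\le h}\in\mathrm{Mat}_{k,h}(\mathbb F_q)$, let $U_i\subseteq\mathbb F_q^k$ be the column space of $G_i$ (nonzero for nondegenerate $\mathcal C$), and $\pi_i=\mathrm{PG}(U_i)$. Then $\mathcal X(\mathcal C)=\{\pi_1,\ldots,\pi_n\}$ (a multiset, well defined up to projective linear transformations). For a multiset $\mathcal X=\{\pi_1,\ldots,\pi_n\}$ of nonempty subspaces of $\mathrm{PG}(k-1,q)$, hyperplanes $\mathrm{PG}(\Lambda_1),\ldots,\mathrm{PG}(\Lambda_t)$ distinguish $\mathcal X$ if for every $i\in[n]$ some $\mathrm{PG}(\Lambda_j)$ does not contain $\pi_i$. $\operatorname{crit}(\mathcal X)$ is the minimum $t\ge1$ for which $t$ distinguishing hyperplanes exist. *)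

(* Defs.v *)
From mathcomp Require Import all_boot all_order all_algebra all_field.
From mathcomp Require Import boolp classical_sets.

Set Implicit Arguments.
Unset Strict Implicit.
Unset Printing Implicit Defensive.

Import GRing.Theory.
Local Open Scope ring_scope.
Local Open Scope classical_set_scope.

(* The least element of [P]; the junk value 0 is returned only when [P] is
   empty. *)
Definition minimum (P : set nat) : nat :=
  xget 0%N [set m | P m /\ (forall m', P m' -> (m <= m')%N)].

Lemma minimumP (P : set nat) : (exists m, P m) ->
  P (minimum P) /\ (forall m, P m -> (minimum P <= m)%N).
Proof.
move=> exP; have exb : exists m, `[< P m >] by case: exP => m /asboolP; exists m.
pose Q := [set m | P m /\ (forall m', P m' -> (m <= m')%N)].
suff : Q (ex_minn exb) by exact: xgetI.
by case: ex_minnP => m /asboolP Pm minm; split => // m' /asboolP /minm.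
Qed.

(* [F] is the field with q elements, and an extension [L] of [F] of degree h is
   the field with q^h elements. Words of length n over [L] are finite functions,
   so that additive codes are [F]-subspaces of [{ffun 'I_n -> L}] (the scalars
   of ['rV[L]_n] would be those of [L]). *)
Section AdditiveCodes.

Variables (F : finFieldType) (L : fieldExtType F) (n : nat).
Implicit Types C D : {vspace {ffun 'I_n -> L}}.

Definition nondegenerate_code C : Prop :=
  forall i : 'I_n, exists2 c, c \in C & c i != 0.

Definition supp D : set 'I_n :=
  \bigcup_(c in [set c | c \in D]) [set i | c i != 0].

Definition crit_code C : nat :=
  minimum [set m | exists D, [/\ (D <= C)%VS, supp D = [set: 'I_n]
                              & \dim D = m]].

Definition generator_matrix k (G : 'M[L]_(k, n)) C : Prop :=
  basis_of C [tuple [ffun i => G j i] | j < k].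

End AdditiveCodes.

Section Projective.

Variables (F : fieldType) (V : vectType F).
Implicit Types U Lambda : {vspace V}.

Definition PG U : set {vspace V} := [set P | \dim P = 1%N /\ (P <= U)%VS].

Definition hyperplane (H : set {vspace V}) : Prop :=
  exists2 Lambda, (\dim Lambda).+1 = \dim {:V} & H = PG Lambda.

(* A multiset of n projective subspaces is given by an enumeration
   [X : 'I_n -> set {vspace V}] with repetitions allowed. *)
Definition distinguish n t (X : 'I_n -> set {vspace V})
    (H : 'I_t -> set {vspace V}) : Prop :=
  forall i, exists j, ~ (X i `<=` H j).

Definition crit_mset n (X : 'I_n -> set {vspace V}) : nat :=
  minimum [set t | (0 < t)%N /\
    exists H : 'I_t -> set {vspace V},
      (forall j, hyperplane (H j)) /\ distinguish X H].

End Projective.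

Section AssociatedMultiset.

Variables (F : finFieldType) (L : fieldExtType F) (n k h : nat).
Variables (G : 'M[L]_(k, n)) (alpha : h.-tuple L).

Definition coord_mx (i : 'I_n) : 'M[F]_(k, h) :=
  \matrix_(j < k, t < h) coord alpha t (G j i).

Definition colspace m p (A : 'M[F]_(m, p)) : {vspace 'cV[F]_m} :=
  <<[seq col t A | t : 'I_p]>>%VS.

Definition assoc_mset (i : 'I_n) : set {vspace 'cV[F]_k} :=
  PG (colspace (coord_mx i)).

End AssociatedMultiset.

(* For nondegenerate codes both minima are attained. *)
Lemma crit_code_ex (F : finFieldType) (L : fieldExtType F) n
    (C : {vspace {ffun 'I_n -> L}}) : nondegenerate_code C ->
  exists m D, [/\ (D <= C)%VS, supp D = [set: 'I_n] & \dim D = m].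
Proof.
move=> ndC; exists (\dim C), C; split => //.
apply/seteqP; split => // i _.
by have [c cC ci] := ndC i; exists c.
Qed.

Lemma colspace_neq0 (F : finFieldType) (L : fieldExtType F) n k h
    (C : {vspace {ffun 'I_n -> L}}) (G : 'M[L]_(k, n)) (alpha : h.-tuple L) :
  nondegenerate_code C -> generator_matrix G C -> basis_of {:L} alpha ->
  forall i, colspace (coord_mx G alpha i) != 0%VS.
Proof.
move=> ndC /andP[/eqP spanG _] /andP[/eqP spanA _] i.
have [c cC ci] := ndC i.
apply: contraNneq ci => U0.
have Gi0 j : G j i = 0.
  rewrite (@coord_span _ _ _ alpha (G j i)) ?spanA ?memvf//.
  rewrite big1 // => t _.
  have : col t (coord_mx G alpha i) \in colspace (coord_mx G alpha i).
    by apply/memv_span/map_f; rewrite mem_enum.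
  rewrite U0 memv0 => /eqP /colP /(_ j).
  by rewrite !mxE => ->; rewrite scale0r.
move: cC; rewrite -spanG => /coord_span ->.
rewrite sum_ffunE big1 // => j _.
by rewrite -tnth_nth tnth_mktuple !ffunE Gi0 scaler0.
Qed.

Lemma crit_mset_ex (F : finFieldType) (V : vectType F) n
    (U : 'I_n -> {vspace V}) : (0 < n)%N -> (forall i, U i != 0%VS) ->
  exists t, (0 < t)%N /\ exists H : 'I_t -> set {vspace V},
    (forall j, hyperplane (H j)) /\ distinguish (fun i => PG (U i)) H.
Proof.
move=> n0 U0; exists n; split => //.
have pick_neq0 i : vpick (U i) != 0 by rewrite vpick0.
exists (fun i => PG (<[vpick (U i)]>^C)%VS); split => [j|i].
  exists (<[vpick (U j)]>^C)%VS => //.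
  by rewrite -(addv_complf <[vpick (U j)]>) dimv_disjoint_sum ?capv_compl //
     dim_vline pick_neq0.
exists i => /(_ <[vpick (U i)]>%VS) [].
  by split; [rewrite dim_vline pick_neq0 | rewrite -memvE memv_pick].
move=> _ /capv_idPl; rewrite capv_compl => /esym/eqP.
by rewrite -dimv_eq0 dim_vline pick_neq0.
Qed.

(* Main.v *)
(** Row vectors [x] of length k parametrize at once the codewords [x G] and the
    vectors normal to the hyperplanes [perp x] of column vectors [y] with
    [x y = 0]. The i-th coordinate of [x G] vanishes exactly when [perp x]
    contains the i-th column space, so generators of a subcode with full support
    and families of distinguishing hyperplanes correspond to each other. *)
Require Import Defs.
From mathcomp Require Import all_boot all_order all_algebra all_field.
From mathcomp Require Import boolp classical_sets.

Set Implicit Arguments.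
Unset Strict Implicit.
Unset Printing Implicit Defensive.

Import GRing.Theory.
Local Open Scope ring_scope.
Local Open Scope classical_set_scope.

Lemma minimum_le (P Q : set nat) :
  (exists m, P m) -> (forall m, P m -> exists2 m', Q m' & (m' <= m)%N) ->
  (minimum Q <= minimum P)%N.
Proof.
move=> /minimumP[Pm _] /(_ _ Pm)[m' Qm' le_m'].
have [|_ minQ] := minimumP (P := Q); first by exists m'.
exact: leq_trans (minQ _ Qm') le_m'.
Qed.

(** A subspace is recovered from its points, since every nonzero vector spans one. *)
Lemma PG_subset (F : fieldType) (V : vectType F) (U W : {vspace V}) :
  PG U `<=` PG W <-> (U <= W)%VS.
Proof.
split=> [sUW | sUW P [dP sPU]]; last by split=> //; apply: subv_trans sUW.
apply/subvP => v vU; have [-> | v_neq0] := eqVneq v 0; first exact: mem0v.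
case: (sUW <[v]>%VS) => [|_]; first split;
  by rewrite -?memvE // dim_vline v_neq0.
Qed.

Section Perp.

Variables (F : fieldType) (k : nat).
Implicit Types x : 'rV[F]_k.

Definition perp x : {vspace 'cV[F]_k} :=
  lker (linfun (mulmx x : 'cV[F]_k -> 'M[F]_1)).

Lemma mem_perp x y : (y \in perp x) = (x *m y == 0).
Proof. by rewrite memv_ker lfunE. Qed.

(** Rank-nullity: the functional $y \mapsto x y$ takes the value $x_j$ on the $j$-th unit vector, so
    it is nonzero and its image is a line. *)
Lemma dim_perp x : x != 0 -> (\dim (perp x)).+1 = \dim {:'cV[F]_k}.
Proof.
move=> x_neq0; set f := linfun (mulmx x : 'cV[F]_k -> 'M[F]_1).
rewrite -(limg_ker_dim f fullv) capfv -addn1; congr (_ + _)%N.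
apply/eqP; rewrite eqn_leq lt0n dimv_eq0; apply/andP; split.
  apply: contraNneq x_neq0 => f0; apply/eqP/rowP => j.
  have : f (delta_mx j 0) \in (f @: fullv)%VS by rewrite memv_img ?memvf.
  rewrite f0 memv0 lfunE /= -colE => /eqP/matrixP/(_ 0 0).
  by rewrite !mxE.
by rewrite (leq_trans (dimvS (subvf _))) // dimvf /dim /= muln1.
Qed.

Lemma hyperplane_perp (Lambda : {vspace 'cV[F]_k}) :
  (\dim Lambda).+1 = \dim {:'cV[F]_k} -> exists x, Lambda = perp x.
Proof.
move=> dimL.
have dimLk : (\dim Lambda).+1 = k by rewrite dimL dimvf /dim /= muln1.
pose M := \matrix_(j < k, t < \dim Lambda) (vbasis Lambda)`_t j 0.
have kerM : kermx M != 0.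
  (* The columns of [M] are a basis of [Lambda]; with $k$ rows and only $k-1$ columns, [M] has a
     nonzero left kernel. *)
  rewrite -mxrank_eq0 mxrank_ker subn_eq0 -ltnNge -[X in (_ < X)%N]dimLk ltnS.
  exact: rank_leq_col.
have [x /sub_kermxP xM x_neq0] := rowV0Pn kerM.
(* Both spaces have codimension 1, so one inclusion suffices. *)
exists x; apply/eqP; rewrite eqEdim -ltnS dim_perp // dimL leqnn andbT.
rewrite -{1}(span_basis (vbasisP Lambda)); apply/span_subvP => b.
case/(nthP 0) => t; rewrite size_tuple => lt_t <-.
rewrite mem_perp; apply/eqP/matrixP => i j.
move/rowP/(_ (Ordinal lt_t)): xM; rewrite !ord1 !mxE => xM.
by rewrite -[RHS]xM; apply: eq_bigr => l _; rewrite !mxE.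
Qed.

End Perp.

Section Codewords.

Variables (F : finFieldType) (L : fieldExtType F) (n k : nat).
Variables (C : {vspace {ffun 'I_n -> L}}) (G : 'M[L]_(k, n)).
Hypothesis genG : generator_matrix G C.
Implicit Types x : 'rV[F]_k.

Definition codeword x : {ffun 'I_n -> L} :=
  \sum_(j < k) x 0 j *: [ffun i => G j i].

Lemma codewordE x i : codeword x i = \sum_(j < k) x 0 j *: G j i.
Proof. by rewrite sum_ffunE; apply: eq_bigr => j _; rewrite !ffunE. Qed.

Lemma codeword_mem x : codeword x \in C.
Proof.
apply: memv_suml => j _; apply/memvZ/(basis_mem genG).
by apply/mapP; exists j; rewrite ?mem_enum.
Qed.

Lemma codewordP c : c \in C -> exists x, c = codeword x.
Proof.
move=> /(coord_basis genG) ->.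
set B := [tuple _ | j < k].
exists (\row_j coord B j c); apply: eq_bigr => j _.
by rewrite mxE -tnth_nth tnth_mktuple.
Qed.

(** The coordinates of the entry $(xG)_i$ in the basis [alpha] are the entries of $x G_i$, and these
    vanish exactly when $x$ annihilates every column of $G_i$. *)
Lemma codeword_eq0 h (alpha : h.-tuple L) x i : basis_of {:L}%VS alpha ->
  (codeword x i == 0) = (colspace (coord_mx G alpha i) <= perp x)%VS.
Proof.
move=> basA; set A := coord_mx G alpha i.
have coordE t : coord alpha t (codeword x i) = (x *m A) 0 t.
  rewrite codewordE linear_sum mxE; apply: eq_bigr => j _.
  by rewrite linearZ /= mxE.
have -> : (codeword x i == 0) = (x *m A == 0).
  apply/eqP/eqP => [c0 | xA0].
      by apply/rowP => t; rewrite -coordE c0 linear0 mxE.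
  rewrite (coord_basis basA (memvf (codeword x i))) big1 // => t _.
  by rewrite coordE xA0 mxE scale0r.
apply/eqP/span_subvP => [xA0 _ /mapP[t _ ->] | sAx].
  by rewrite mem_perp colE mulmxA xA0 mul0mx.
apply/rowP => t; have := sAx _ (map_f _ (mem_enum _ t)).
by rewrite mem_perp colE mulmxA -colE => /eqP/colP/(_ 0); rewrite !mxE.
Qed.

End Codewords.

(** Evaluation at [i] is linear: if all generators vanish there, so does their span. *)
Lemma supp_span (F : finFieldType) (L : fieldExtType F) n
    (s : seq {ffun 'I_n -> L}) (i : 'I_n) :
  supp <<s>>%VS i <-> exists2 c, c \in s & c i != 0.
Proof.
split=> [[c /= cs ci] | [c cs ci]]; last by exists c => //=; apply: memv_span.
apply: contrapT => nos; move: ci; apply/negP/negPn.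
rewrite (coord_span (X := in_tuple s) cs) sum_ffunE big1 // => j _.
rewrite ffunE /=; have [-> | sj] := eqVneq (s`_j i) 0; first exact: scaler0.
by case: nos; exists s`_j => //; apply: mem_nth.
Qed.

Theorem proposition3p9 (F : finFieldType) (L : fieldExtType F) (h n k : nat)
    (h_gt0 : (0 < h)%N) (n_gt0 : (0 < n)%N) (k_gt0 : (0 < k)%N)
    (dimL : \dim {:L}%VS = h)
    (C : {vspace {ffun 'I_n -> L}}) (dimC : \dim C = k)
    (G : 'M[L]_(k, n)) (genG : generator_matrix G C)
    (alpha : h.-tuple L) (basis_alpha : basis_of {:L}%VS alpha)
    (ndC : nondegenerate_code C) :
  crit_code C = crit_mset (assoc_mset G alpha).
Proof.
have cw_neq0 x i :
    codeword G x i != 0 <-> ~ (assoc_mset G alpha i `<=` PG (perp x)).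
  rewrite (codeword_eq0 _ _ _ basis_alpha).
  by split=> [/negP ns /PG_subset // | ns]; apply/negP => /PG_subset.
apply/eqP; rewrite eqn_leq; apply/andP; split; apply: minimum_le.
- exact/crit_mset_ex/(colspace_neq0 ndC).
(* Normal vectors of distinguishing hyperplanes give codewords generating a subcode of full
   support. *)
- move=> t [_ [H [hypH distH]]].
  have [x Hx] : {x : 'I_t -> 'rV[F]_k & forall j, H j = PG (perp (x j))}.
    apply: (choice (P := fun j x => H j = PG (perp x))) => j.
    have [Lambda dimLambda ->] := hypH j.
    by have [x ->] := hyperplane_perp dimLambda; exists x.
  pose s := [tuple codeword G (x j) | j < t].
  (* These codewords may be dependent, so [t] only bounds the dimension from above. *)
  exists (\dim <<s>>); last by rewrite (leq_trans (dim_span _)) ?size_tuple.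
  exists <<s>>%VS; split=> //.
    by apply/span_subvP => _ /mapP[j _ ->]; apply: codeword_mem.
  apply/seteqP; split=> // i _; apply/supp_span.
  have [j] := distH i; rewrite Hx => /cw_neq0 cj.
  by exists (codeword G (x j)) => //; apply/map_f/mem_enum.
- exact: crit_code_ex.
(* Conversely, a basis of [D] already covers every coordinate, and each basis vector yields one
   hyperplane. *)
- move=> m [D [sDC suppD dimD]]; exists m => //.
  have suppB i : exists j : 'I_m, (vbasis D)`_j i != 0.
    have : supp <<vbasis D>>%VS i by rewrite (span_basis (vbasisP D)) suppD.
    case/supp_span => _ /(nthP 0)[j ltjD <-].
    by rewrite size_tuple dimD in ltjD; exists (Ordinal ltjD).
  have [x Dx] : {x : 'I_m -> 'rV[F]_k &
      forall j : 'I_m, (vbasis D)`_j = codeword G (x j)}.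
    apply: (choice (P := fun (j : 'I_m) x => (vbasis D)`_j = codeword G x)) => j.
    apply/(codewordP genG)/(subvP sDC)/vbasis_mem.
    by rewrite mem_nth // size_tuple dimD.
  split.
    (* As $n > 0$, some basis vector is nonzero at the first coordinate, so $m \geq 1$. *)
    by have [j _] := suppB (Ordinal n_gt0); apply: leq_ltn_trans (ltn_ord j).
  exists (fun j => PG (perp (x j))); split=> [j | i].
    exists (perp (x j)) => //; apply: dim_perp.
    (* A basis vector is nonzero, hence so is its coefficient vector [x j], and [perp (x j)] is a
       genuine hyperplane. *)
    have : (vbasis D)`_j != 0.
      apply: (free_not0 (basis_free (vbasisP D))).
      by rewrite mem_nth // size_tuple dimD.
    apply: contraNneq => x0; rewrite Dx x0 /codeword big1 // => l _.
    by rewrite mxE scale0r.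
  by have [j] := suppB i; rewrite Dx => /cw_neq0; exists j.
Qed.
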